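(* Let $Q=Q(N,E)$ be a finite graph with at least two nodes in which every node is incident to at least one edge, let $T\ge 2$ be an even integer, and let $V$ be the value of the periodic patrolling game on $Q$ with period $T$ and attack duration $2$. Let $\hat{\mu}$ be the fractional covering number and $\hat{\nu}$ the fractional independence number of $Q$. Then $$V=\frac{1}{\hat{\mu}}=\frac{1}{\hat{\nu}}.$$ Moreover, for any optimal edge weighting $\mu$, it is an optimal strategy for the Patroller to oscillate on edge $e$ with probability $\mu(e)/\hat{\mu}$ for each $e\in E$; and for any optimal node weighting $\nu$ and any fixed time interval $\{t,t+1\}$, it is an optimal strategy for the Attacker to attack during $\{t,t+1\}$ at node $i$ with probability $\nu(i)/\hat{\nu}$ for each $i\in N$.
   Context: Graphs are simple and undirected. The periodic patrolling game on a graph $Q$ with node set $N$, edge set $E$, period $T$ and attack duration $2$ is the following finite zero-sum game. Times form the time circle $\{1,2,\dots,T\}$ with arithmetic modulo $T$. A pure strategy of the Patroller (a patrol) is a walk $w:\{1,2,\ldots\}\to N$ such that $w(t)$ and $w(t+1)$ are the same or adjacent nodes and $w(t+T)=w(t)$ for all $t$. A pure strategy of the Attacker is a pair consisting of a node $i\in N$ and an attack interval $J=\{t,t+1\}$ of two consecutive times (modulo $T$). The patrol $w$ intercepts the attack if $w(s)=i$ for some $s\in J$; the payoff (to the Patroller, who maximizes; the Attacker minimizes) is $1$ if the attack is intercepted and $0$ otherwise. Both players may use mixed strategies; $V$ is the value of the game (expected payoff, i.e. interception probability, under optimal play). An optimal edge weighting is a function $\mu:E\to[0,1]$ minimizing the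 total weight $\sum_{e\in E}\mu(e)$ subject to the condition that for every node $i\in N$ the weights $\mu(e)$ of the edges $e$ incident to $i$ sum to at least $1$; the minimum total weight $\hat{\mu}$ is the fractional covering number. An optimal node weighting is a function $\nu:N\to[0,1]$ maximizing the total weight $\sum_{i\in N}\nu(i)$ subject to the condition that for every edge the sum of the weights of its two endpoints is at most $1$; the maximum total weight $\hat{\nu}$ is the fractional independence number. For even $T$, to oscillate on an edge means to use the $T$-periodic walk that alternates between the two endpoints of the edge at successive times. *)

(* Defs.v *)
From mathcomp Require Import all_boot all_order all_algebra.
From mathcomp Require Import classical_sets reals.

Set Implicit Arguments.
Unset Strict Implicit.
Unset Printing Implicit Defensive.

Import Order.TTheory GRing.Theory Num.Theory.
Local Open Scope ring_scope.

(* [u a b] is what the column player pays to the row player. *)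

Definition mixed (R : realType) (A : finType) (x : A -> R) : Prop :=
  (forall a, 0 <= x a) /\ \sum_a x a = 1.

Definition expected_payoff (R : realType) (A B : finType) (u : A -> B -> R)
    (x : A -> R) (y : B -> R) : R :=
  \sum_a \sum_b x a * y b * u a b.

Definition maximin (R : realType) (A B : finType) (u : A -> B -> R) : R :=
  sup [set inf [set expected_payoff u x y | y in @mixed R B]
      | x in @mixed R A]%classic.

Definition minimax (R : realType) (A B : finType) (u : A -> B -> R) : R :=
  inf [set sup [set expected_payoff u x y | x in @mixed R A]
      | y in @mixed R B]%classic.

Definition is_game_value (R : realType) (A B : finType) (u : A -> B -> R)
    (v : R) : Prop :=
  v = maximin u /\ v = minimax u.

Definition optimal_maximizer (R : realType) (A B : finType)
    (u : A -> B -> R) (v : R) (x : A -> R) : Prop :=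
  mixed x /\ forall y : B -> R, mixed y -> v <= expected_payoff u x y.

Definition optimal_minimizer (R : realType) (A B : finType)
    (u : A -> B -> R) (v : R) (y : B -> R) : Prop :=
  mixed y /\ forall x : A -> R, mixed x -> expected_payoff u x y <= v.

Definition edges (N : finType) (adj : rel N) : {set {set N}} :=
  [set e : {set N} | [exists x, exists y, adj x y && (e == [set x; y])]].

Definition edge (N : finType) (adj : rel N) : Type :=
  {e : {set N} | e \in edges adj}.

Definition edge_weighting (R : realType) (N : finType) (adj : rel N)
    (mu : edge adj -> R) : Prop :=
  (forall e, 0 <= mu e <= 1) /\
  (forall i : N, 1 <= \sum_(e : edge adj | i \in val e) mu e).

Definition optimal_edge_weighting (R : realType) (N : finType) (adj : rel N)
    (mu : edge adj -> R) : Prop :=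
  edge_weighting mu /\
  forall mu' : edge adj -> R, edge_weighting mu' ->
    \sum_e mu e <= \sum_e mu' e.

Definition fractional_covering_number (R : realType) (N : finType)
    (adj : rel N) : R :=
  inf [set \sum_e mu e | mu in @edge_weighting R N adj]%classic.

Definition node_weighting (R : realType) (N : finType) (adj : rel N)
    (nu : N -> R) : Prop :=
  (forall i, 0 <= nu i <= 1) /\
  (forall e : edge adj, \sum_(i in val e) nu i <= 1).

Definition optimal_node_weighting (R : realType) (N : finType) (adj : rel N)
    (nu : N -> R) : Prop :=
  node_weighting adj nu /\
  forall nu' : N -> R, node_weighting adj nu' ->
    \sum_i nu i >= \sum_i nu' i.

Definition fractional_independence_number (R : realType) (N : finType)
    (adj : rel N) : R :=
  sup [set \sum_i nu i | nu in @node_weighting R N adj]%classic.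

(* The time circle is ['I_T], time [T] being identified with [0]; [ordS] is
   [t |-> t + 1] modulo [T].  A [T]-periodic walk is given by its restriction
   to one period. *)
Definition is_patrol (N : finType) (adj : rel N) (T : nat)
    (w : {ffun 'I_T -> N}) : bool :=
  [forall t, (w t == w (ordS t)) || adj (w t) (w (ordS t))].

Definition patrol (N : finType) (adj : rel N) (T : nat) : Type :=
  {w : {ffun 'I_T -> N} | is_patrol adj w}.

(* Intervals are sets of times, so for [T = 2] there is only one of them. *)
Definition attack_interval (T : nat) : Type :=
  {J : {set 'I_T} | [exists t, J == [set t; ordS t]]}.

Definition attack (N : finType) (T : nat) : Type :=
  (N * attack_interval T)%type.

Definition intercepts (N : finType) (adj : rel N) (T : nat)
    (w : patrol adj T) (a : attack N T) : bool :=
  [exists s in val a.2, val w s == a.1].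

Definition patrolling_payoff (R : realType) (N : finType) (adj : rel N)
    (T : nat) (w : patrol adj T) (a : attack N T) : R :=
  (intercepts w a)%:R.

Definition oscillation (N : finType) (T : nat) (x y : N) : {ffun 'I_T -> N} :=
  [ffun t : 'I_T => if odd t then y else x].

(* Oscillate on [e] with probability [p e].  Each edge carries two
   oscillations, which differ by a time shift; [h e] and [k e] are meant to be
   the endpoints of [e], and the one used starts from [h e] at time [0]. *)
Definition oscillation_strategy (R : realType) (N : finType) (adj : rel N)
    (T : nat) (h k : edge adj -> N) (p : edge adj -> R)
    (w : patrol adj T) : R :=
  \sum_(e : edge adj | val w == oscillation T (h e) (k e)) p e.

(* Attack during [{t, t+1}], at node [i] with probability [q i]. *)
Definition fixed_interval_strategy (R : realType) (N : finType) (T : nat)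
    (t : 'I_T) (q : N -> R) (a : attack N T) : R :=
  if val a.2 == [set t; ordS t] then q a.1 else 0.

(* Main.v *)
(* The game value is [1 / m] as soon as an edge weighting and a node weighting
   have the same total [m]: oscillating on [e] intercepts every attack at an
   endpoint of [e], and a patrol visits during [{t, t+1}] a single node or the
   two ends of one edge.  Such weightings exist in half-integers: in the
   bipartite double cover the smallest edge cover and the largest independent
   set have the same size by Koenig's theorem, and projecting them to the graph
   with weight 1/2 on each element gives the two weightings. *)
Require Import Defs.
From mathcomp Require Import all_boot all_order all_algebra.
From mathcomp Require Import zify.
From mathcomp Require Import classical_sets reals.

Set Implicit Arguments.
Unset Strict Implicit.
Unset Printing Implicit Defensive.

Import Order.TTheory GRing.Theory Num.Theory.
Local Open Scope ring_scope.

(** * Matchings, covers and independent sets in bipartite multigraphs *)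

(* The edges of a bipartite multigraph on [X + Y] are the elements of [I], with
   endpoints [f] and [g]; making [f] and [g] interchangeable spares half of the
   proofs. *)
Definition vertex_cover (I X Y : finType) (f : I -> X) (g : I -> Y)
    (E : {set I}) (A : {set X}) (B : {set Y}) : bool :=
  [forall p in E, (f p \in A) || (g p \in B)].

Lemma vertex_coverC (I X Y : finType) (f : I -> X) (g : I -> Y)
    (E : {set I}) (A : {set X}) (B : {set Y}) :
  vertex_cover g f E B A = vertex_cover f g E A B.
Proof. by apply: eq_forallb => p; rewrite orbC. Qed.

(* Two edges [e], [e'] with a common endpoint would make the small covers
   [(A1, B1)] of [E :\ e] and [(A2, B2)] of [E :\ e'] combine into the covers
   [(A1 :&: A2, B1 :|: B2)] and [(f e |: A1 :|: A2, B1 :&: B2)] of [E], whose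
   total size is less than [2 n]. *)
Lemma vertex_cover_critical_inj (I X Y : finType) (f : I -> X) (g : I -> Y)
    (E : {set I}) (n : nat) :
    (forall A B, vertex_cover f g E A B -> n <= #|A| + #|B|)%N ->
    (forall e, e \in E ->
       exists A B, vertex_cover f g (E :\ e) A B /\ (#|A| + #|B| < n)%N) ->
  {in E &, injective f}.
Proof.
move=> lb crit e e' eE e'E fee'; apply/eqP/negPn/negP => nee'.
(* A cover of [E :\ d] that also met [d] would cover [E] with fewer than [n] vertices. *)
have small d A B : vertex_cover f g (E :\ d) A B -> (#|A| + #|B| < n)%N ->
    (f d \notin A) && (g d \notin B).
  move=> cov; rewrite -negb_or ltnNge; apply: contra => dAB; apply: lb.
  apply/forall_inP => p pE; have [->//|npd] := eqVneq p d.
  by apply: (forall_inP cov); rewrite in_setD1 npd.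
have [A1 [B1 [c1 s1]]] := crit e eE.
have [A2 [B2 [c2 s2]]] := crit e' e'E.
have /andP[feA1 geB1] := small _ _ _ c1 s1.
have /andP[feA2 geB2] := small _ _ _ c2 s2.
(* [(A1, B1)] must cover [e'], and cannot do so at the shared endpoint, which is outside [A1]. *)
have ge'B1 : g e' \in B1.
  have := forall_inP c1 e'; rewrite in_setD1 eq_sym nee' e'E -fee'.
  by rewrite (negbTE feA1); apply.
have geB2' : g e \in B2.
  have := forall_inP c2 e; rewrite in_setD1 nee' eE fee'.
  by rewrite (negbTE feA2); apply.
have lb1 : (n <= #|A1 :&: A2| + #|B1 :|: B2|)%N.
  apply: lb; apply/forall_inP => p pE; rewrite !inE.
  have [->|npe] := eqVneq p e; first by rewrite geB2' !orbT.
  have [->|npe'] := eqVneq p e'; first by rewrite ge'B1 !orbT.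
  have := forall_inP c1 p; have := forall_inP c2 p.
  rewrite !in_setD1 npe npe' pE => /(_ isT) + /(_ isT).
  by do !case: (_ \in _).
have lb2 : (n <= #|f e |: (A1 :|: A2)| + #|B1 :&: B2|)%N.
  apply: lb; apply/forall_inP => p pE; rewrite !inE.
  have [->|npe] := eqVneq p e; first by rewrite eqxx.
  have [->|npe'] := eqVneq p e'; first by rewrite fee' eqxx.
  have := forall_inP c1 p; have := forall_inP c2 p.
  rewrite !in_setD1 npe npe' pE => /(_ isT) + /(_ isT).
  by do !case: (_ \in _); rewrite ?orbT.
(* Adding [f e] costs at most one, so the two combined covers total at most [2 (n - 1) + 1]. *)
have le3 : (#|f e |: (A1 :|: A2)| <= #|A1 :|: A2|.+1)%N.
  by rewrite cardsU1 -add1n leq_add2r leq_b1.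
move: s1 s2 lb1 lb2 le3 (cardsUI A1 A2) (cardsUI B1 B2); clear; lia.
Qed.

(** Induction on [#|E|]. If deleting some edge does not lower the minimum cover size, a matching
    found without that edge is large enough. Otherwise [E] is critical, hence itself a matching. *)
Lemma konig (I X Y : finType) (f : I -> X) (g : I -> Y) (E : {set I}) :
  exists (M : {set I}) (A : {set X}) (B : {set Y}),
    [/\ M \subset E, {in M &, injective f}, {in M &, injective g},
        vertex_cover f g E A B & (#|A| + #|B| <= #|M|)%N].
Proof.
have [m] := ubnP #|E|; elim: m E => // m IH E Em.
have covT : vertex_cover f g E (f @: E) finset.set0.
  by apply/forall_inP => p pE; rewrite imset_f.
pose sz (C : {set X} * {set Y}) := (#|C.1| + #|C.2|)%N.
have [[A B] /= cov0 min0] :=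
  @arg_minnP _ (f @: E, finset.set0) (fun C => vertex_cover f g E C.1 C.2) sz covT.
have minE A' B' : vertex_cover f g E A' B' -> (#|A| + #|B| <= #|A'| + #|B'|)%N.
  by move=> /(min0 (A', B')).
have [/existsP[e /andP[eE /forallP big]]|/existsPn crit] :=
  boolP [exists e, (e \in E) && [forall C : {set X} * {set Y},
    vertex_cover f g (E :\ e) C.1 C.2 ==> (#|A| + #|B| <= #|C.1| + #|C.2|)%N]].
  have [|M [A' [B' [ME injf injg cov' le']]]] := IH (E :\ e).
    by move: Em; rewrite (cardsD1 e) eE add1n ltnS.
  exists M, A, B; split=> //; first exact: fintype.subset_trans ME (subD1set _ _).
  by apply: leq_trans le'; have /implyP := big (A', B'); apply.
have {}crit e : e \in E -> exists A' B',
    vertex_cover f g (E :\ e) A' B' /\ (#|A'| + #|B'| < #|A| + #|B|)%N.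
  move=> eE; have := crit e; rewrite eE /= => /forallPn[[A' B']] /=.
  by rewrite negb_imply -ltnNge => /andP[c' s']; exists A', B'.
exists E, A, B; split=> //.
- exact: vertex_cover_critical_inj minE crit.
- apply: (@vertex_cover_critical_inj _ _ _ g f E (#|A| + #|B|)).
    by move=> B' A'; rewrite vertex_coverC (addnC #|B'|); apply: minE.
  move=> e /crit[A' [B' [c' s']]]; exists B', A'.
  by rewrite vertex_coverC (addnC #|B'|).
(* The left endpoints alone cover [E], so a minimum cover has at most [#|E|] vertices. *)
- by apply: leq_trans (minE _ _ covT) _; rewrite cards0 addn0 leq_imset_card.
Qed.

(** [F] is a Koenig matching [M] plus one edge at each unmatched vertex, so it has at most
    [#|X| + #|Y| - #|M|] edges. [S] and [U] are the complement of a vertex cover of size at most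
    [#|M|]. *)
Lemma bipartite_gallai (I X Y : finType) (f : I -> X) (g : I -> Y)
    (E : {set I}) :
    (forall x, exists2 p, p \in E & f p = x) ->
    (forall y, exists2 p, p \in E & g p = y) ->
  exists (F : {set I}) (S : {set X}) (U : {set Y}),
    [/\ F \subset E, forall x, exists2 p, p \in F & f p = x,
        forall y, exists2 p, p \in F & g p = y,
        forall p, p \in E -> ~~ ((f p \in S) && (g p \in U))
      & (#|F| <= #|S| + #|U|)%N].
Proof.
move=> fE gE; have [M [A [B [ME injf injg cov le]]]] := konig f g E.
have fE' x : exists p, (p \in E) && (f p == x).
  by have [p pE <-] := fE x; exists p; rewrite pE eqxx.
have gE' y : exists p, (p \in E) && (g p == y).
  by have [p pE <-] := gE y; exists p; rewrite pE eqxx.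
pose a x := xchoose (fE' x); pose b y := xchoose (gE' y).
have aE x : a x \in E by have /andP[] := xchooseP (fE' x).
have bE y : b y \in E by have /andP[] := xchooseP (gE' y).
have fa x : f (a x) = x by have /andP[_ /eqP] := xchooseP (fE' x).
have gb y : g (b y) = y by have /andP[_ /eqP] := xchooseP (gE' y).
exists (M :|: (a @: ~: (f @: M)) :|: (b @: ~: (g @: M))), (~: A), (~: B).
split.
- by rewrite !finset.subUset ME; apply/andP; split; apply/fintype.subsetP => _ /imsetP[z _ ->].
- move=> x; have [/imsetP[p pM ->]|xM] := boolP (x \in f @: M).
    by exists p => //; rewrite !inE pM.
  by exists (a x) => //; rewrite !inE imset_f ?orbT // inE.
- move=> y; have [/imsetP[p pM ->]|yM] := boolP (y \in g @: M).
    by exists p => //; rewrite !inE pM.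
  by exists (b y) => //; rewrite !inE imset_f ?orbT // inE.
- by move=> p pE; rewrite !inE -negb_or negbK; apply: (forall_inP cov).
have lea := leq_imset_card a (~: (f @: M)).
have leb := leq_imset_card b (~: (g @: M)).
have leU1 := leq_card_setU (M :|: a @: (~: (f @: M))) (b @: (~: (g @: M))).
have leU2 := leq_card_setU M (a @: (~: (f @: M))).
have := cardsC (f @: M); have := cardsC (g @: M).
rewrite (card_in_imset injf) (card_in_imset injg).
move: le (cardsC A) (cardsC B) lea leb leU1.1 leU2.1; clear; lia.
Qed.

(** * Duality of edge and node weightings *)

(** Double counting of [nu i * mu e] over incident pairs: covering bounds it below node by node,
    packing bounds it above edge by edge. *)
Lemma edge_weightings_ge_node_weightings (R : realType) (N : finType)
    (adj : rel N) (mu : edge adj -> R) (nu : N -> R) :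
    edge_weighting mu -> node_weighting adj nu ->
  \sum_i nu i <= \sum_e mu e.
Proof.
move=> [mu01 cov] [nu01 pack].
apply: (@le_trans _ _ (\sum_i \sum_(e : edge adj | i \in val e) nu i * mu e)).
  apply: ler_sum => i _; rewrite -mulr_sumr ler_peMr //.
  by have /andP[] := nu01 i.
rewrite (exchange_big_dep predT) //=; apply: ler_sum => e _.
rewrite -mulr_suml ler_piMl //; last exact: pack.
by have /andP[] := mu01 e.
Qed.

Lemma edgeP (N : finType) (adj : rel N) (e : edge adj) :
  exists x y, adj x y /\ val e = [set x; y].
Proof.
have := valP e; rewrite inE => /existsP[x /existsP[y /andP[xy /eqP ->]]].
by exists x, y.
Qed.

Lemma edge_of (N : finType) (adj : rel N) (x y : N) :
  adj x y -> exists e : edge adj, val e = [set x; y].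
Proof.
move=> xy; have xyE : [set x; y] \in edges adj.
  by rewrite inE; apply/existsP; exists x; apply/existsP; exists y;
     rewrite xy eqxx.
by exists (exist (fun e => e \in edges adj) _ xyE).
Qed.

Lemma edge_node_weighting_duality (R : realType) (N : finType) (adj : rel N)
    (adj_sym : symmetric adj) (adj_irr : irreflexive adj)
    (no_isolated : forall i : N, exists e : edge adj, i \in val e) :
  exists (mu : edge adj -> R) (nu : N -> R),
    [/\ edge_weighting mu, node_weighting adj nu
      & \sum_e mu e = \sum_i nu i].
Proof.
(* The double cover: each edge contributes both its orientations, and [S], [U] will lie in the two
   copies of [N]. *)
pose E := [set p : N * N | adj p.1 p.2].
have nbr i : exists j, adj i j.
  have [e] := no_isolated i; have [x [y [xy ->]]] := edgeP e.
  by rewrite !inE => /orP[] /eqP ->; [exists y | exists x; rewrite adj_sym].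
have [|| F [S [U [FE F1 F2 indep leF]]]] := @bipartite_gallai _ _ _ fst snd E.
- by move=> x; have [y xy] := nbr x; exists (x, y); rewrite ?inE.
- by move=> y; have [x yx] := nbr y; exists (x, y); rewrite ?inE //= adj_sym.
have adjF p : p \in F -> adj p.1 p.2.
  by move=> /(fintype.subsetP FE); rewrite inE.
pose mu (e : edge adj) : R :=
  2^-1 * \sum_(p in F | [set p.1; p.2] == val e) 1.
pose nu i : R := 2^-1 * ((i \in S)%:R + (i \in U)%:R).
have half_ge0 : 0 <= 2^-1 :> R by rewrite invr_ge0.
(* Every arc of [F] projects to exactly one edge, so totals of [mu] are half-counts of arcs. *)
have sum_mu (P : pred {set N}) : \sum_(e : edge adj | P (val e)) mu e =
    2^-1 * \sum_(p in F | P [set p.1; p.2]) 1.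
  rewrite -mulr_sumr; congr (_ * _).
  rewrite (exchange_big_dep (fun p => (p \in F) && P [set p.1; p.2])) /=; last first.
    by move=> e p Pe /andP[-> /eqP ->].
  apply: eq_bigr => p /andP[pF Pp]; have [e0 e0p] := edge_of (adjF p pF).
  rewrite (big_pred1 e0) // => e /=; rewrite -e0p (inj_eq val_inj) eq_sym pF /=.
  by case: eqP => [->|]; rewrite ?andbF // e0p Pp.
have mu_ok : edge_weighting mu.
  split=> [e | i].
    apply/andP; split; first by rewrite mulr_ge0 // sumr_ge0.
    rewrite ler_pdivrMl // mulr1 sumr_const ler_nat.
    have [x [y [xy ->]]] := edgeP e.
    (* At most two arcs, the two orientations, project to a given edge. *)
    apply: (@leq_trans #|[set (x, y); (y, x)]|); last by rewrite cards2; case: eqP.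
    apply: subset_leq_card; apply/fintype.subsetP => -[a b].
    rewrite !inE => /andP[abF /eqP /= ab].
    have nab : a != b by apply: contraTneq (adjF _ abF) => /= ->; rewrite adj_irr.
    have : a \in [set x; y] by rewrite -ab set21.
    have : b \in [set x; y] by rewrite -ab set22.
    rewrite !inE !xpair_eqE => /orP[] /eqP bE /orP[] /eqP aE.
    - by rewrite aE bE eqxx in nab.
    - by rewrite aE bE !eqxx orbT.
    - by rewrite aE bE !eqxx.
    - by rewrite aE bE eqxx in nab.
  rewrite (sum_mu (fun s => i \in s)) ler_pdivlMl // mulr1 sumr_const ler_nat.
  (* [F] has an arc leaving [i] and an arc entering [i]. They differ because there are no loops, so
     [i] receives at least two halves. *)
  have [[a b] p1F /= ai] := F1 i; have [[c d] p2F /= di] := F2 i.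
  have ne : (a, b) != (c, d).
    rewrite xpair_eqE ai di; apply: contraTN (adjF _ p1F) => /andP[_ /eqP ->] /=.
    by rewrite ai adj_irr.
  have -> : 2%N = #|[set (a, b); (c, d)]| by rewrite cards2 ne.
  apply: subset_leq_card; apply/fintype.subsetP => p; rewrite !inE.
  rewrite unfold_in.
  by move=> /orP[] /eqP -> /=; rewrite !inE ?p1F ?p2F ?ai ?di eqxx ?orbT.
have nu_ok : node_weighting adj nu.
  split=> [i | e].
    by rewrite mulr_ge0 ?addr_ge0 //= ler_pdivrMl // mulr1 -natrD ler_nat
      (leq_add (leq_b1 _) (leq_b1 _)).
  have [x [y [xy ->]]] := edgeP e.
  have nxy : x != y by apply: contraTneq xy => ->; rewrite adj_irr.
  have yx : adj y x by rewrite adj_sym.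
  rewrite big_setU1 ?inE //= big_set1 -mulrDr ler_pdivrMl // mulr1 -!natrD ler_nat.
  (* Independence for each orientation allows at most one of [x \in S], [y \in U] and at most one of
     [y \in S], [x \in U]. *)
  have := indep (x, y); have := indep (y, x); rewrite !inE xy yx /=.
  by move=> /(_ isT) + /(_ isT); do 4!case: (_ \in _).
exists mu, nu; split=> //; apply/le_anti/andP; split; last first.
  exact: edge_weightings_ge_node_weightings.
rewrite (sum_mu predT) -mulr_sumr ler_pM2l ?invr_gt0 // big_split /=.
have sum_mem (A : {set N}) : \sum_i (i \in A)%:R = #|A|%:R :> R.
  rewrite -sum1_card natr_sum [RHS]big_mkcond /=; apply: eq_bigr => i _.
  by case: (i \in A).
rewrite !sum_mem -natrD (eq_bigl (mem F)) => [|p]; last by rewrite /= andbT.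
by rewrite sumr_const ler_nat.
Qed.

(** * Mixed strategies and the value of a finite game *)

Lemma expected_payoff_ge (R : realType) (A B : finType) (u : A -> B -> R)
    (x : A -> R) (y : B -> R) (v : R) :
  mixed y -> (forall b, v <= \sum_a x a * u a b) -> v <= expected_payoff u x y.
Proof.
move=> [y0 y1] le; rewrite /expected_payoff exchange_big /=.
rewrite -[v]mul1r -y1 mulr_suml; apply: ler_sum => b _.
under eq_bigr => a _ do rewrite mulrAC mulrC.
by rewrite -mulr_sumr ler_wpM2l.
Qed.

Lemma expected_payoff_le (R : realType) (A B : finType) (u : A -> B -> R)
    (x : A -> R) (y : B -> R) (v : R) :
  mixed x -> (forall a, \sum_b y b * u a b <= v) -> expected_payoff u x y <= v.
Proof.
move=> [x0 x1] le; rewrite /expected_payoff.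
rewrite -[v]mul1r -x1 mulr_suml; apply: ler_sum => a _.
under eq_bigr => b _ do rewrite -mulrA.
by rewrite -mulr_sumr ler_wpM2l.
Qed.

(** Supplies the bounds without which the real [inf] and [sup] in [maximin] and [minimax] could not
    be compared with individual payoffs. *)
Lemma expected_payoff_bounded (R : realType) (A B : finType) (u : A -> B -> R)
    (x : A -> R) (y : B -> R) :
  mixed x -> mixed y -> `|expected_payoff u x y| <= \sum_a \sum_b `|u a b|.
Proof.
have le1 (C : finType) (z : C -> R) c : mixed z -> `|z c| <= 1.
  by move=> [z0 <-]; rewrite ger0_norm // (bigD1 c) //= lerDl sumr_ge0.
move=> mx my; apply: le_trans (ler_norm_sum _ _ _) _; apply: ler_sum => a _.
apply: le_trans (ler_norm_sum _ _ _) _; apply: ler_sum => b _.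
by rewrite !normrM ler_piMl // mulr_ile1 // le1.
Qed.

(** The guarantee [lo] of any row strategy is at most [v], since [y] holds the payoff down to [v],
    and [x] attains [v]. The same holds dually for [hi]. *)
Lemma optimal_is_game_value (R : realType) (A B : finType) (u : A -> B -> R)
    (v : R) (x : A -> R) (y : B -> R) :
  optimal_maximizer u v x -> optimal_minimizer u v y -> is_game_value u v.
Proof.
move=> [mx vx] [my vy].
have bnd x' y' : mixed x' -> mixed y' ->
    - (\sum_a \sum_b `|u a b|) <= expected_payoff u x' y' <= \sum_a \sum_b `|u a b|.
  by move=> mx' my'; rewrite -ler_norml expected_payoff_bounded.
pose lo x' := inf [set expected_payoff u x' y' | y' in @mixed R B]%classic.
pose hi y' := sup [set expected_payoff u x' y' | x' in @mixed R A]%classic.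
have lo_le x' y' : mixed x' -> mixed y' -> lo x' <= expected_payoff u x' y'.
  move=> mx' my'; apply: ge_inf; last by exists y'.
  exists (- (\sum_a \sum_b `|u a b|)) => _ [z mz <-].
  by have /andP[] := bnd _ _ mx' mz.
have hi_ge x' y' : mixed x' -> mixed y' -> expected_payoff u x' y' <= hi y'.
  move=> mx' my'; apply: ub_le_sup; last by exists x'.
  exists (\sum_a \sum_b `|u a b|) => _ [z mz <-].
  by have /andP[] := bnd _ _ mz my'.
have lo_v x' : mixed x' -> lo x' <= v.
  by move=> mx'; apply: le_trans (lo_le _ _ mx' my) (vy _ mx').
have hi_v y' : mixed y' -> v <= hi y'.
  by move=> my'; apply: le_trans (vx _ my') (hi_ge _ _ mx my').
split; apply/le_anti/andP; split.
- apply: (@le_trans _ _ (lo x)).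
    by apply: lb_le_inf => [|_ [z mz <-]]; [exists (expected_payoff u x y), y | exact: vx].
  by apply: ub_le_sup; [exists v => _ [z mz <-]; exact: lo_v | exists x].
- by apply: ge_sup => [|_ [z mz <-]]; [exists (lo x), x | exact: lo_v].
- by apply: lb_le_inf => [|_ [z mz <-]]; [exists (hi y), y | exact: hi_v].
- apply: (@le_trans _ _ (hi y)).
    by apply: ge_inf; [exists v => _ [z mz <-]; exact: hi_v | exists y].
  by apply: ge_sup => [|_ [z mz <-]]; [exists (expected_payoff u x y), x | exact: vy].
Qed.

(** * Totals of optimal weightings *)

Lemma sum_optimal_edge_weighting (R : realType) (N : finType) (adj : rel N)
    (mu : edge adj -> R) :
  optimal_edge_weighting mu -> \sum_e mu e = fractional_covering_number R adj.
Proof.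
move=> [mu_ok mu_min]; apply/le_anti/andP; split.
  by apply: lb_le_inf => [|_ [m m_ok <-]]; [exists (\sum_e mu e), mu | exact: mu_min].
apply: ge_inf; last by exists mu.
by exists (\sum_e mu e) => _ [m m_ok <-]; exact: mu_min.
Qed.

Lemma sum_optimal_node_weighting (R : realType) (N : finType) (adj : rel N)
    (nu : N -> R) :
  optimal_node_weighting adj nu ->
  \sum_i nu i = fractional_independence_number R adj.
Proof.
move=> [nu_ok nu_max]; apply/le_anti/andP; split.
  apply: ub_le_sup; last by exists nu.
  by exists (\sum_i nu i) => _ [m m_ok <-]; exact: nu_max.
by apply: ge_sup => [|_ [m m_ok <-]]; [exists (\sum_i nu i), nu | exact: nu_max].
Qed.

(** * Oscillating patrols and attacks in a fixed interval *)

(** Evenness of [T] makes parity alternate also across the wrap from [T - 1] to [0]. *)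
Lemma odd_ordS (T : nat) (t : 'I_T) : ~~ odd T -> odd (ordS t) = ~~ odd t.
Proof. by move=> Teven; rewrite /= odd_mod //; apply/negbTE. Qed.

Lemma oscillation_is_patrol (N : finType) (adj : rel N) (T : nat) (x y : N) :
  symmetric adj -> ~~ odd T -> adj x y -> is_patrol adj (oscillation T x y).
Proof.
move=> adj_sym Teven xy; apply/forallP => t; rewrite !ffunE odd_ordS //.
by case: (odd t); rewrite /= ?xy 1?adj_sym ?xy orbT.
Qed.

Lemma oscillation_visits (N : finType) (T : nat) (x y i : N) (t : 'I_T) :
    ~~ odd T -> i \in [set x; y] ->
  [exists s in [set t; ordS t], oscillation T x y s == i].
Proof.
move=> Teven; rewrite !inE => ixy; apply/existsP.
have [at_t|not_at_t] := eqVneq (oscillation T x y t) i.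
  by exists t; rewrite !inE eqxx at_t eqxx.
exists (ordS t); rewrite !inE eqxx orbT /=.
move: not_at_t ixy; rewrite !ffunE odd_ordS //.
by case: (odd t) => /=; rewrite !(eq_sym i) => /negbTE ->; rewrite ?orbF.
Qed.

(** Change of variables: the strategy is the image of the weights [p] under [o], which need not be
    injective. *)
Lemma sum_oscillation_strategy (R : realType) (N : finType) (adj : rel N)
    (T : nat) (h k : edge adj -> N) (p : edge adj -> R)
    (o : edge adj -> patrol adj T) (F : patrol adj T -> R) :
    (forall e, val (o e) = oscillation T (h e) (k e)) ->
  \sum_w oscillation_strategy h k p w * F w = \sum_e p e * F (o e).
Proof.
move=> oE; under eq_bigr => w _ do rewrite /oscillation_strategy mulr_suml.
rewrite (exchange_big_dep predT) //=; apply: eq_bigr => e _.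
by rewrite (big_pred1 (o e)) // => w /=; rewrite -oE (inj_eq val_inj).
Qed.

Lemma sum_fixed_interval_strategy (R : realType) (N : finType) (T : nat)
    (t : 'I_T) (q : N -> R) (J : attack_interval T) (F : attack N T -> R) :
    val J = [set t; ordS t] ->
  \sum_a fixed_interval_strategy t q a * F a = \sum_i q i * F (i, J).
Proof.
move=> JE; pose G i K := fixed_interval_strategy t q (i, K) * F (i, K).
rewrite (eq_bigr (fun a => G a.1 a.2)) => [|[]//].
rewrite -(pair_bigA _ G) /=; apply: eq_bigr => i _.
rewrite (bigD1 J) //= /G /fixed_interval_strategy /= -JE eqxx big1 ?addr0 // => K.
by rewrite (inj_eq val_inj) => /negbTE ->; rewrite mul0r.
Qed.

Lemma oscillation_strategy_optimal (R : realType) (N : finType) (adj : rel N)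
    (T : nat) (mu : edge adj -> R) (h k : edge adj -> N) :
    symmetric adj -> irreflexive adj -> ~~ odd T ->
    edge_weighting mu -> 0 < \sum_e mu e ->
    (forall e, val e = [set h e; k e]) ->
  optimal_maximizer (@patrolling_payoff R N adj T) (1 / \sum_e mu e)
    (oscillation_strategy h k (fun e => mu e / \sum_e mu e)).
Proof.
move=> adj_sym adj_irr Teven [mu01 cov] m0 hk; set m := \sum_e mu e in m0 *.
have p0 e : 0 <= mu e / m.
  by apply: divr_ge0 (ltW m0); have /andP[] := mu01 e.
(* The equality of sets fixes the endpoints only up to order; irreflexivity rules out the degenerate
   cases. *)
have hk_adj e : adj (h e) (k e).
  have [x [y [xy e_xy]]] := edgeP e.
  have : x \in [set h e; k e] by rewrite -hk e_xy set21.
  have : y \in [set h e; k e] by rewrite -hk e_xy set22.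
  rewrite !inE => /orP[] /eqP yE /orP[] /eqP xE; move: xy; rewrite xE yE //.
  - by rewrite adj_irr.
  - by rewrite adj_sym.
  - by rewrite adj_irr.
pose o e : patrol adj T := exist (fun w => is_patrol adj w) _
  (oscillation_is_patrol adj_sym Teven (hk_adj e)).
have oE e : val (o e) = oscillation T (h e) (k e) by [].
split; first split.
- by move=> w; apply: sumr_ge0 => e _; apply: p0.
- under eq_bigr => w _ do rewrite -[oscillation_strategy _ _ _ _]mulr1.
  rewrite (sum_oscillation_strategy _ _ oE) -mulr_suml mulr1 -mulr_suml.
  by rewrite divff ?gt_eqF.
move=> y my; apply: expected_payoff_ge => // -[i J].
rewrite (sum_oscillation_strategy _ _ oE).
(* Only the oscillations on edges at [i] are kept; each of them intercepts the attack. *)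
apply: (@le_trans _ _ (\sum_(e : edge adj | i \in val e) mu e / m)).
  by rewrite -mulr_suml ler_wpM2r // invr_ge0 ltW.
rewrite big_mkcond; apply: ler_sum => e _; case: ifP => ie; last first.
  by rewrite mulr_ge0 // ler0n.
rewrite /patrolling_payoff /intercepts /=.
have /existsP[t /eqP ->] := valP J.
by rewrite oscillation_visits ?mulr1 // -hk.
Qed.

Lemma fixed_interval_strategy_optimal (R : realType) (N : finType)
    (adj : rel N) (T : nat) (nu : N -> R) (t : 'I_T) :
    node_weighting adj nu -> 0 < \sum_i nu i ->
  optimal_minimizer (@patrolling_payoff R N adj T) (1 / \sum_i nu i)
    (fixed_interval_strategy t (fun i => nu i / \sum_i nu i)).
Proof.
move=> [nu01 pack] m0; set m := \sum_i nu i in m0 *.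
have nu0 i : 0 <= nu i by have /andP[] := nu01 i.
have q0 i : 0 <= nu i / m by apply: divr_ge0 (ltW m0).
have tJ : [exists s : 'I_T, [set t; ordS t] == [set s; ordS s]].
  by apply/existsP; exists t.
pose J : attack_interval T :=
  exist (fun K : {set 'I_T} => [exists s, K == [set s; ordS s]]) _ tJ.
have JE : val J = [set t; ordS t] by [].
split; first split.
- by move=> a; rewrite /fixed_interval_strategy; case: ifP.
- under eq_bigr => a _ do rewrite -[fixed_interval_strategy _ _ _]mulr1.
  rewrite (sum_fixed_interval_strategy _ _ JE) -mulr_suml mulr1 -mulr_suml.
  by rewrite divff ?gt_eqF.
move=> x mx; apply: expected_payoff_le => // w.
rewrite (sum_fixed_interval_strategy _ _ JE).
under eq_bigr => i _ do rewrite mulrAC.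
rewrite -mulr_suml ler_wpM2r ?invr_ge0 ?(ltW m0) //.
apply: (@le_trans _ _ (\sum_(i in [set val w t; val w (ordS t)]) nu i)).
  rewrite [leRHS]big_mkcond; apply: ler_sum => i _.
  rewrite /patrolling_payoff /intercepts /=.
  case: existsP => [[s /andP[]]|_]; last by rewrite mulr0; case: ifP.
  by rewrite !inE => /orP[] /eqP -> /eqP ->; rewrite eqxx ?orbT mulr1.
(* A patrol that stays put is handled by [nu <= 1], a moving one by the constraint of the edge it
   crosses. *)
have /orP[/eqP <-|adj_w] := forallP (valP w) t.
  by rewrite finset.setUid big_set1; have /andP[] := nu01 (val w t).
by have [e <-] := edge_of adj_w; apply: pack.
Qed.

(** * The value of the patrolling game *)

Theorem theorem5 (R : realType) (N : finType) (adj : rel N) (T : nat)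
    (adj_sym : symmetric adj) (adj_irr : irreflexive adj)
    (N_ge2 : (2 <= #|N|)%N)
    (no_isolated : forall i : N, exists e : edge adj, i \in val e)
    (T_ge2 : (2 <= T)%N) (T_even : ~~ odd T) :
  let u : patrol adj T -> attack N T -> R := @patrolling_payoff R N adj T in
  let muhat : R := fractional_covering_number R adj in
  let nuhat : R := fractional_independence_number R adj in
  (exists mu : edge adj -> R, optimal_edge_weighting mu) /\
  (exists nu : N -> R, optimal_node_weighting adj nu) /\
  exists V : R,
    [/\ is_game_value u V,
        V = 1 / muhat,
        V = 1 / nuhat,
        forall (mu : edge adj -> R) (h k : edge adj -> N),
          optimal_edge_weighting mu ->
          (forall e, val e = [set h e; k e]) ->
          optimal_maximizer u V
            (oscillation_strategy h k (fun e => mu e / muhat))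
      & forall (nu : N -> R) (t : 'I_T),
          optimal_node_weighting adj nu ->
          optimal_minimizer u V
            (fixed_interval_strategy t (fun i => nu i / nuhat))].
Proof.
move=> u muhat nuhat.
have [mu0 [nu0 [mu0_ok nu0_ok eq0]]] :=
  edge_node_weighting_duality R adj_sym adj_irr no_isolated.
have mu0_opt : optimal_edge_weighting mu0.
  split=> // mu mu_ok; rewrite eq0.
  exact: edge_weightings_ge_node_weightings.
have nu0_opt : optimal_node_weighting adj nu0.
  split=> // nu nu_ok; rewrite -eq0.
  exact: edge_weightings_ge_node_weightings.
have mu_hat (mu : edge adj -> R) : optimal_edge_weighting mu -> \sum_e mu e = muhat.
  exact: sum_optimal_edge_weighting.
have nu_hat (nu : N -> R) : optimal_node_weighting adj nu -> \sum_i nu i = nuhat.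
  exact: sum_optimal_node_weighting.
have hatE : muhat = nuhat by rewrite -(mu_hat _ mu0_opt) eq0 nu_hat.
have hat0 : 0 < muhat.
  (* Covering a single node already takes total weight at least [1]. *)
  have /card_gt0P[i _] : (0 < #|N|)%N by apply: ltnW.
  rewrite -(mu_hat _ mu0_opt); apply: (lt_le_trans ltr01).
  apply: le_trans (mu0_ok.2 i) _; rewrite big_mkcond; apply: ler_sum => e _.
  by case: ifP => // _; have /andP[] := mu0_ok.1 e.
have patroller (mu : edge adj -> R) (h k : edge adj -> N) :
    optimal_edge_weighting mu -> (forall e, val e = [set h e; k e]) ->
    optimal_maximizer u (1 / muhat)
      (oscillation_strategy h k (fun e => mu e / muhat)).
  move=> mu_opt hk; rewrite -(mu_hat mu mu_opt).
  by apply: oscillation_strategy_optimal; rewrite ?mu_hat //; case: mu_opt.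
have attacker (nu : N -> R) (t : 'I_T) : optimal_node_weighting adj nu ->
    optimal_minimizer u (1 / muhat)
      (fixed_interval_strategy t (fun i => nu i / nuhat)).
  move=> nu_opt; rewrite hatE -(nu_hat nu nu_opt).
  by apply: fixed_interval_strategy_optimal; rewrite ?nu_hat -?hatE //; case: nu_opt.
split; first by exists mu0.
split; first by exists nu0.
exists (1 / muhat); split=> //; last by rewrite hatE.
(* To instantiate the Patroller's strategy, an order of the endpoints is chosen for every edge; the
   Attacker's interval starts at time [0]. *)
have /fin_all_exists2[h _] : forall e : edge adj, exists2 x, true & 
    exists y, val e = [set x; y].
  by move=> e; have [x [y [_ ->]]] := edgeP e; exists x => //; exists y.
move=> /fin_all_exists[k hk].
apply: optimal_is_game_value (patroller mu0 h k mu0_opt hk)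
  (attacker nu0 (Ordinal (ltnW T_ge2)) nu0_opt).
Qed.
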